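(* Let $P$ be a naturally labeled poset on $[n]=\{1,\dots,n\}$. Then the $h^*$-polynomial of the enriched chain polytope $\mathcal{E}_P$ is $$h^*(\mathcal{E}_P,x)=(x+1)^n\,W_P^{(\ell)}\!\left(\frac{4x}{(x+1)^2}\right),$$ where $W_P^{(\ell)}(x)$ is the left peak polynomial of $P$. In particular, $h^*(\mathcal{E}_P,x)$ is $\gamma$-positive. Moreover, $h^*(\mathcal{E}_P,x)$ is real-rooted if and only if $W_P^{(\ell)}(x)$ is real-rooted.
   Context: A poset $P$ on $[n]$ with order $<_P$ is naturally labeled if $i<_P j$ implies $i<j$ as integers. An antichain of $P$ is a subset of pairwise incomparable elements (the empty set is an antichain). The enriched chain polytope $\mathcal{E}_P\subset\mathbb{R}^n$ is the convex hull of $\{\pm\mathbf{e}_{i_1}\pm\dots\pm\mathbf{e}_{i_k}:\{i_1,\dots,i_k\}\text{ is an antichain of }P\}$ (all sign choices; the empty antichain gives the origin), where $\mathbf{e}_i$ is the $i$-th unit coordinate vector. It is a lattice polytope of dimension $n$. For a lattice polytope $\mathcal{P}\subset\mathbb{R}^n$ of dimension $n$, put $L_{\mathcal{P}}(m)=|m\mathcal{P}\cap\mathbb{Z}^n|$ for positive integers $m$. The $h^*$-polynomial $h^*(\mathcal{P},x)$ is the polynomial defined by $$1+\sum_{k\ge 1}L_{\mathcal{P}}(k)x^k=\frac{h^*(\mathcal{P},x)}{(1-x)^{n+1}}.$$ $\mathcal{L}(P)$ is the set of linear extensions of $P$, i.e. permutations $\pi=(\pi_1,\dots,\pi_n)$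 of $[n]$ such that $\pi_a<_P\pi_b$ implies $a<b$. A left peak of $\pi$ is an index $1\le i\le n-1$ with $\pi_{i-1}<\pi_i>\pi_{i+1}$, where $\pi_0=0$; $\mathrm{pk}^{(\ell)}(\pi)$ is the number of left peaks. The left peak polynomial is $W_P^{(\ell)}(x)=\sum_{\pi\in\mathcal{L}(P)}x^{\mathrm{pk}^{(\ell)}(\pi)}$. A real polynomial $f$ of degree $d$ is palindromic if $f(x)=x^d f(x^{-1})$. It is $\gamma$-positive if it is palindromic and there are $\gamma_0,\dots,\gamma_{\lfloor d/2\rfloor}\ge 0$ with $f(x)=\sum_{i\ge 0}\gamma_i x^i(1+x)^{d-2i}$. A polynomial is real-rooted if all its roots are real. *)

(* Defs.v *)
From HB Require Import structures.
From mathcomp Require Import all_boot all_order all_algebra all_fingroup.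
From mathcomp Require Import finmap.
From mathcomp Require Import boolp classical_sets functions cardinality reals.
From mathcomp Require Import complex.

Set Implicit Arguments.
Unset Strict Implicit.
Unset Printing Implicit Defensive.

Import Order.TTheory GRing.Theory Num.Theory.

Local Open Scope ring_scope.

(* The label i + 1 of [n] = {1, ..., n} is represented by i : 'I_n, and a poset
   by its strict order lt. *)

Definition naturally_labeled (n : nat) (lt : rel 'I_n) : Prop :=
  forall i j : 'I_n, lt i j -> (i < j)%N.

Definition antichain (n : nat) (lt : rel 'I_n) (A : {set 'I_n}) : Prop :=
  {in A &, forall i j, i != j -> ~~ lt i j /\ ~~ lt j i}.

Section Polytopes.
Variables (R : realType) (n : nat).
Implicit Types (V E : set 'rV[R]_n).

Definition convex_hull V : set 'rV[R]_n :=
  [set x | exists (k : nat) (w : 'I_k -> R) (v : 'I_k -> 'rV[R]_n),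
     [/\ forall i, 0 <= w i, \sum_i w i = 1, forall i, V (v i)
       & x = \sum_i w i *: v i]]%classic.

Definition enriched_points (lt : rel 'I_n) : set 'rV[R]_n :=
  [set x | exists (A : {set 'I_n}) (s : 'I_n -> bool),
     antichain lt A /\ x = \sum_(i in A) (-1) ^+ s i *: delta_mx 0 i]%classic.

Definition enriched_chain_polytope (lt : rel 'I_n) : set 'rV[R]_n :=
  convex_hull (enriched_points lt).

Definition integer_points : set 'rV[R]_n :=
  [set x : 'rV[R]_n | forall i, x 0 i \is a Num.int]%classic.

(* fset_set sends an infinite set to the empty set, but a dilate of a polytope
   is bounded and contains finitely many integer points. *)
Definition lattice_count E (m : nat) : nat :=
  #|` fset_set ([set m%:R *: x | x in E] `&` integer_points)%classic|.

Definition ehrhart_series_coef E (k : nat) : nat :=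
  if k is 0%N then 1%N else lattice_count E k.

(* h is the product of the formal power series with coefficients
   ehrhart_series_coef E k by (1 - x)^(n + 1), written coefficientwise. *)
Definition is_hstar E (h : {poly R}) : Prop :=
  forall k : nat,
    h`_k = \sum_(i < k.+1)
             ((1 - 'X) ^+ n.+1 : {poly R})`_i * (ehrhart_series_coef E (k - i))%:R.

End Polytopes.

Arguments enriched_chain_polytope R {n} lt.

Section LinearExtensions.
Variables (n : nat) (lt : rel 'I_n).

(* For a, b : 'I_n, pi a is the letter (0-based) at position a (0-based). *)
Definition linear_extension (pi : {perm 'I_n}) : bool :=
  [forall a : 'I_n, forall b : 'I_n, lt (pi a) (pi b) ==> (a < b)%N].

(* The word pi_0 pi_1 ... pi_n, with letters in {1, ..., n} and pi_0 = 0. *)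
Definition letters (pi : {perm 'I_n}) : seq nat :=
  0%N :: [seq (val (pi a)).+1 | a <- enum 'I_n].

Definition is_left_peak (pi : {perm 'I_n}) (i : nat) : bool :=
  let p := nth 0%N (letters pi) in (p i.-1 < p i)%N && (p i.+1 < p i)%N.

Definition left_peaks (pi : {perm 'I_n}) : nat :=
  \sum_(1 <= i < n | is_left_peak pi i) 1.

Definition left_peak_poly (R : nzRingType) : {poly R} :=
  \sum_(pi : {perm 'I_n} | linear_extension pi) 'X^(left_peaks pi).

End LinearExtensions.

Section Polynomials.
Variable R : realType.
Implicit Types (f : {poly R}).

Definition ratconst (c : R) : {fraction {poly R}} := tofrac c%:P.

(* The value of f at a rational function q of x. *)
Definition subst_frac f (q : {fraction {poly R}}) : {fraction {poly R}} :=
  (map_poly ratconst f).[q].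

Definition degree f : nat := (size f).-1.

Definition palindromic f : Prop :=
  tofrac f = tofrac 'X ^+ degree f * subst_frac f (tofrac 'X)^-1.

Definition gamma_positive f : Prop :=
  palindromic f /\
  exists g : 'I_(degree f)./2.+1 -> R,
    (forall i, 0 <= g i) /\
    f = \sum_i g i *: ('X^i * (1 + 'X) ^+ (degree f - i.*2)).

Definition real_rooted f : Prop :=
  forall z : complex R, root (map_poly (real_complex R) f) z -> complex.Im z = 0.

End Polynomials.

(* Main.v *)
(** An integer point of the dilate m E_P is encoded by a labeling g of P with
    values in the chain 0 < -1 < 1 < ... < -m < m: the coordinate at i is, up to
    the sign of g i, the increment of |g i| over the maximum of |g j| for
    j <_P i.  This is Stanley's transfer map with signs, and its image consists
    of the left enriched P-partitions.  Sorting the elements of P by value, ties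
    being broken by increasing (resp. decreasing) labels for nonnegative (resp.
    negative) values, splits these labelings according to the linear extensions
    of P.  For a fixed linear extension pi, counting the labelings letter by
    letter gives the generating function
    (1 + x)^(n - 2 pk) (4 x)^pk / (1 - x)^(n + 1), where pk is the number of
    left peaks of pi.  Real-rootedness is transferred by u = 4 z / (1 + z)^2,
    since every real root of W_P is negative. *)
Require Import Defs.
From mathcomp Require Import all_boot all_algebra reals.
From mathcomp Require Import all_order all_fingroup finmap zify ring lra.
From mathcomp Require Import boolp classical_sets cardinality complex.

Import Order.TTheory GRing.Theory Num.Theory.
Local Open Scope ring_scope.

Set Implicit Arguments.
Unset Strict Implicit.
Unset Printing Implicit Defensive.

(** * Multiplication of a sequence, seen as a power series, by a polynomial *)

Section SeriesAction.
Variable R : comNzRingType.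
Implicit Types (p q : {poly R}) (T : nat -> R).

(** The same sum as in [is_hstar], which thus becomes an identity on [conv] with (1 - x)^(n + 1). *)
Definition conv p T (k : nat) : R := \sum_(i < k.+1) p`_i * T (k - i)%N.

Lemma eq_conv p T T' : T =1 T' -> conv p T =1 conv p T'.
Proof. by move=> eqT k; apply: eq_bigr => i _; rewrite eqT. Qed.

Lemma conv_trunc p T (K k : nat) :
  (k < K)%N -> conv p T k = (p * \poly_(i < K) T i)`_k.
Proof.
move=> ltkK; rewrite coefM; apply: eq_bigr => i _.
by rewrite coef_poly (leq_ltn_trans (leq_subr _ _) ltkK).
Qed.

Lemma conv_mul p q T : conv (p * q) T =1 conv p (conv q T).
Proof.
move=> k; rewrite (conv_trunc _ _ (ltnSn k)) -mulrA coefM.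
apply: eq_bigr => i _; congr (_ * _).
by rewrite -conv_trunc // ltnS leq_subr.
Qed.

Lemma conv_coef p q : conv p (nth 0 q) =1 nth 0 (p * q).
Proof. by move=> k; rewrite coefM. Qed.

Lemma conv_sum (I : Type) (r : seq I) (P : pred I) p (F : I -> nat -> R) k :
  conv p (fun j => \sum_(i <- r | P i) F i j) k = \sum_(i <- r | P i) conv p (F i) k.
Proof.
by rewrite /conv exchange_big; apply: eq_bigr => i _; rewrite mulr_sumr.
Qed.

Lemma conv_affine (a b : R) T k :
  conv (a%:P + b%:P * 'X) T k = a * T k + (if k is j.+1 then b * T j else 0).
Proof.
rewrite /conv big_ord_recl /= coefD coefMX coefC addr0 subn0.
congr (_ + _); case: k => [|k]; first by rewrite big_ord0.
rewrite big_ord_recl big1 => [|i _]; rewrite !(coefD, coefCM, coefX, coefC) /=.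
  by rewrite addr0 mulr1 add0r subSS subn0.
by rewrite mulr0 addr0 mul0r.
Qed.

(** A recurrence T_k - T_(k-1) = a T'_k + b T'_(k-1) adds one factor 1 - x to the denominator and
    multiplies the numerator by a + b x. *)
Lemma conv_step (a b : R) q (N : nat) T T' :
  conv (1 - 'X) T =1 conv (a%:P + b%:P * 'X) T' ->
  conv ((1 - 'X) ^+ N) T' =1 nth 0 q ->
  conv ((1 - 'X) ^+ N.+1) T =1 nth 0 ((a%:P + b%:P * 'X) * q).
Proof.
move=> eqT eqT' k; rewrite exprSr conv_mul (eq_conv _ eqT) -conv_mul mulrC.
by rewrite conv_mul (eq_conv _ eqT') conv_coef.
Qed.

End SeriesAction.

(** * Labelings of a word *)

Definition enriched_lt (a b : nat * nat) : bool :=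
  (a.2 < b.2)%N || (a.2 == b.2) && (if odd a.2 then b.1 < a.1 else a.1 < b.1)%N.

(** Here k is the room M - v left above the last value v, and j the room left after the next letter.
    For even M, k has the parity of v, so [odd k] detects a negative value. *)
Fixpoint chain_count (l0 : nat) (w : seq nat) (k : nat) : nat :=
  if w is l :: w' then
    \sum_(j < k.+1 | (j < k)%N || (if odd k then l < l0 else l0 < l)%N)
      chain_count l w' j
  else 1.

Definition falls (l0 : nat) (w : seq nat) : bool :=
  if w is l :: _ then (l < l0)%N else false.

Fixpoint peaks (l0 : nat) (w : seq nat) : nat :=
  if w is l :: w' then ((l0 < l)%N && falls l w') + peaks l w' else 0.

Lemma sum_tuple_cons (T : finType) (n : nat) (F : n.+1.-tuple T -> nat) :
  (\sum_(t : n.+1.-tuple T) F t =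
   \sum_(x : T) \sum_(t : n.-tuple T) F (cons_tuple x t))%N.
Proof.
rewrite pair_big /=.
apply: (reindex (fun p : T * n.-tuple T => cons_tuple p.1 p.2)).
exists (fun t : n.+1.-tuple T => (thead t, behead_tuple t)) => [[x t] _|t _].
  by congr (_, _); apply: val_inj.
by apply: val_inj; rewrite /= [in RHS](tuple_eta t).
Qed.

Lemma chain_countE (M n l0 v : nat) (w : seq nat) :
  ~~ odd M -> size w = n -> (v <= M)%N ->
  (\sum_(t : n.-tuple 'I_M.+1) path enriched_lt (l0, v) (zip w (map val t)) =
   chain_count l0 w (M - v))%N.
Proof.
move=> evM; elim: n l0 v w => [|n IH] l0 v [|l w] //= => [_ _|[szw] levM].
  rewrite (eq_bigr (fun=> 1%N)) => [|t _]; first by rewrite sum1_card card_tuple.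
  by rewrite tuple0.
rewrite sum_tuple_cons.
under eq_bigr => x _.
  have lexM : (x <= M)%N by rewrite -ltnS.
  have -> : (\sum_(t : n.-tuple 'I_M.+1)
      (enriched_lt (l0, v) (l, val x) && path enriched_lt (l, val x) (zip w (map val t)))
    = if enriched_lt (l0, v) (l, val x) then chain_count l w (M - x) else 0)%N.
    case: ifP => _ /=; last by rewrite big1.
    exact: IH.
  over.
rewrite /= -big_mkcond (reindex_inj rev_ord_inj) /=.
have ltMv : ((M - v).+1 <= M.+1)%N by rewrite ltnS leq_subr.
rewrite (big_ord_widen_cond M.+1 (fun j => (j < M - v)%N ||
  (if odd (M - v) then l < l0 else l0 < l)%N) (chain_count l w) ltMv).
apply: eq_big => [j|j _]; last first.
  by rewrite subSS subKn // -ltnS.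
rewrite /enriched_lt /= subSS oddB // (negbTE evM) /=.
have := ltn_ord j; rewrite ltnS => lejM.
have -> : (v == M - j)%N = (j == M - v :> nat)%N by apply/eqP/eqP; lia.
have -> : (v < M - j)%N = (j < M - v)%N by apply/idP/idP; lia.
rewrite ltnS [X in _ = _ && X]leq_eqVlt.
by case: ltngtP; case: ifP; rewrite ?andbT ?andbF.
Qed.

Lemma chain_count_evenS (l0 l k : nat) (w : seq nat) : (l0 < l)%N ->
  chain_count l0 (l :: w) k.*2 = (\sum_(j < k.*2.+1) chain_count l w j)%N.
Proof. by move=> lt0; apply: eq_bigl => j; rewrite odd_double lt0 orbT. Qed.

Lemma chain_count_falls0 (l0 : nat) (w : seq nat) :
  falls l0 w -> chain_count l0 w 0 = 0.
Proof.
case: w => //= l w ltl; rewrite big_pred0 // => j.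
by rewrite /= ltnNge ltnW.
Qed.

(** A tie needs a descent in odd room and an ascent in even room. So j goes up to 2k + 1 for a
    descent, as in room 2k + 2, and up to 2k for an ascent, as in room 2k. *)
Lemma chain_count_odd (l0 k : nat) (w : seq nat) : uniq (l0 :: w) ->
  chain_count l0 w k.*2.+1 = chain_count l0 w (k + falls l0 w).*2.
Proof.
case: w => //= l w /andP[]; rewrite inE negb_or => /andP[nel _] _.
rewrite odd_double /=; case: ltngtP nel => //= ltl _.
  rewrite addn1 odd_double doubleS [RHS]big_mkcond big_ord_recr /= ltnn addn0.
  by apply: eq_big => [j|j _]; rewrite ?orbT // ltn_ord.
rewrite addn0 odd_double big_mkcond big_ord_recr /= ltnn addn0.
by apply: eq_big => [j|j _]; rewrite ?orbT // ltn_ord.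
Qed.

(** * Generating function of the labelings of a word *)

Section ChainSeries.
Variable R : comNzRingType.

Definition even_count (l0 : nat) (w : seq nat) (k : nat) : R :=
  (chain_count l0 w k.*2)%:R.

Lemma even_count_rec0 (l0 l : nat) (w : seq nat) :
  even_count l0 (l :: w) 0 = (l0 < l)%N%:R * even_count l w 0.
Proof.
rewrite /even_count /= big_mkcond big_ord1 /=.
by case: ifP => _; rewrite ?mul1r ?mul0r.
Qed.

(** Two more units of room add two values of j: 2k + 1 and 2k + 2 for an ascent to l, 2k and 2k + 1
    for a descent. [chain_count_odd] brings the odd one back to even room. *)
Lemma even_count_recS (l0 l k : nat) (w : seq nat) : uniq [:: l0, l & w] ->
  even_count l0 (l :: w) k.+1 = even_count l0 (l :: w) k
   + even_count l w (k + (l0 < l)%N)%N + even_count l w (k + falls l w)%N.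
Proof.
move=> unilw; have unw : uniq (l :: w) by case/andP: unilw.
rewrite /even_count -(chain_count_odd _ unw) -!natrD; congr _%:R.
have nel : l0 != l by case/andP: unilw; rewrite inE negb_or => /andP[].
case: (ltngtP l0 l) nel => // ltl _.
  rewrite addn1 (chain_count_evenS _ _ ltl) (chain_count_evenS k _ ltl).
  by rewrite doubleS !big_ord_recr /= addnAC.
rewrite addn0.
have fl : falls l0 (l :: w) by [].
have := chain_count_odd k unilw; rewrite fl addn1 => <-.
have -> : chain_count l0 (l :: w) k.*2.+1 = (\sum_(j < k.*2.+2) chain_count l w j)%N.
  by apply: eq_bigl => j; rewrite /= odd_double /= ltl orbT.
have -> : chain_count l0 (l :: w) k.*2 = (\sum_(j < k.*2) chain_count l w j)%N.
  rewrite /= odd_double big_mkcond big_ord_recr /= ltnn ltnNge (ltnW ltl) addn0.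
  by apply: eq_bigr => j _; rewrite ltn_ord.
by rewrite !big_ord_recr.
Qed.

Lemma even_count_falls0 (l0 : nat) (w : seq nat) :
  falls l0 w -> even_count l0 w 0 = 0.
Proof. by move=> fl; rewrite /even_count chain_count_falls0. Qed.

(** Each peak is paired with the letter after it, and these pairs are disjoint; an initial descent
    lands on a letter outside all of them. The bound keeps the subtractions in exponents exact. *)
Lemma peaks_bound (l0 : nat) (w : seq nat) :
  ((peaks l0 w).*2 + falls l0 w <= size w)%N.
Proof.
elim: w l0 => //= l w IH l0.
by have := IH l; case: ltngtP => //=; case: (falls l w); lia.
Qed.

(* Letter by letter, the generating function acquires the factor
   (1 + x) / (1 - x) between two steps of the same kind (ascent or descent),
   2 / (1 - x) from an ascent to a descent and 2 x / (1 - x) from a descent to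
   an ascent. *)
Lemma even_count_series (l0 : nat) (w : seq nat) : uniq (l0 :: w) ->
  conv ((1 - 'X) ^+ (size w).+1) (even_count l0 w) =1
  nth 0 ((1 + 'X) ^+ (size w - ((peaks l0 w).*2 + falls l0 w)) *
         (2%:R *: 'X) ^+ falls l0 w * (4%:R *: 'X) ^+ peaks l0 w).
Proof.
have subXE : (1 - 'X : {poly R}) = 1%:P + (-1)%:P * 'X.
  by rewrite polyCN mulN1r.
elim: w l0 => [|l w IH] l0 uniw.
  move=> k; rewrite /= !mulr1 subXE conv_affine coefC /even_count /=.
  by case: k => [|k]; rewrite ?addr0 ?mulr1 // subrr.
have unw : uniq (l :: w) by case/andP: uniw.
have nel : l0 != l by case/andP: uniw; rewrite inE negb_or => /andP[].
have bnd := peaks_bound l w.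
have natX (m : nat) : (m%:R *: 'X : {poly R}) = m%:R * 'X.
  by rewrite -mul_polyC polyC_natr.
set q := _ * _ * _.
have rec (a b : R) :
    even_count l0 (l :: w) 0 = a * even_count l w 0 ->
    (forall k, even_count l w (k + (l0 < l)%N)%N + even_count l w (k + falls l w)%N
      = a * even_count l w k.+1 + b * even_count l w k) ->
    q = (a%:P + b%:P * 'X) * ((1 + 'X) ^+ (size w - ((peaks l w).*2 + falls l w)) *
         (2%:R *: 'X) ^+ falls l w * (4%:R *: 'X) ^+ peaks l w) ->
  conv ((1 - 'X) ^+ (size w).+2) (even_count l0 (l :: w)) =1 nth 0 q.
  move=> rec0 recS ->; apply: conv_step (IH l unw) => k.
  rewrite subXE !conv_affine mul1r; case: k => [|k]; first by rewrite !addr0.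
  by rewrite even_count_recS // -recS; ring.
rewrite {}/q /= !natX in rec *.
(* The cases compare the step into l with the step out of it; the end of the word counts as an
   ascent, since [falls] is then false. *)
case: (ltngtP l0 l) nel rec => // ltl _ /= rec; case fl: (falls l w) rec bnd => /= rec bnd.
- apply: (rec 2%:R 0).
  + by rewrite even_count_rec0 even_count_falls0 ?mulr0.
  + by move=> k; rewrite addn1; ring.
  + have -> : ((size w).+1 - ((1 + peaks l w).*2 + 0) =
               size w - ((peaks l w).*2 + 1))%N by lia.
    by rewrite polyC0 polyC_natr exprD; ring.
- apply: (rec 1 1).
  + by rewrite even_count_rec0 ltl.
  + by move=> k; rewrite addn1 addn0; ring.
  + have -> : ((size w).+1 - ((0 + peaks l w).*2 + 0) =
               (size w - ((peaks l w).*2 + 0)).+1)%N by lia.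
    by rewrite polyC1 add0n exprS; ring.
- apply: (rec 1 1).
  + by rewrite even_count_rec0 even_count_falls0 ?mulr0.
  + by move=> k; rewrite addn1 addn0; ring.
  + have -> : ((size w).+1 - ((0 + peaks l w).*2 + 1) =
               (size w - ((peaks l w).*2 + 1)).+1)%N by lia.
    by rewrite polyC1 add0n exprS; ring.
- apply: (rec 0 2%:R).
  + by rewrite even_count_rec0 ltnNge (ltnW ltl) !mul0r.
  + by move=> k; rewrite addn0; ring.
  + have -> : ((size w).+1 - ((0 + peaks l w).*2 + 1) =
               size w - ((peaks l w).*2 + 0))%N by lia.
    by rewrite polyC0 polyC_natr add0n; ring.
Qed.

End ChainSeries.

(** * Sorting labelings *)

Lemma enriched_lt_irr : irreflexive enriched_lt.
Proof. by move=> [l v]; rewrite /enriched_lt /= !ltnn eqxx; case: ifP. Qed.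

Lemma enriched_lt_trans : transitive enriched_lt.
Proof.
move=> [l2 v2] [l1 v1] [l3 v3]; rewrite /enriched_lt /=.
case/orP=> [lt12|/andP[/eqP-> h12]]; case/orP=> [lt23|/andP[/eqP<- h23]].
- by rewrite (ltn_trans lt12).
- by rewrite lt12.
- by rewrite lt23.
- rewrite eqxx /=; apply/orP; right.
  by case: (odd v2) h12 h23; lia.
Qed.

Lemma enriched_lt_total (a b : nat * nat) :
  a.1 != b.1 -> enriched_lt a b || enriched_lt b a.
Proof.
case: a b => [l v] [l' v'] /=; rewrite /enriched_lt /=.
by case: (ltngtP v v') => //= ->; case: ifP; case: ltngtP.
Qed.

Lemma peaksE (l0 : nat) (w : seq nat) : uniq (l0 :: w) ->
  peaks l0 w = (\sum_(1 <= i < size w |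
    (nth 0 (l0 :: w) i.-1 < nth 0 (l0 :: w) i) &&
    (nth 0 (l0 :: w) i.+1 < nth 0 (l0 :: w) i)) 1)%N.
Proof.
elim: w l0 => [|l w IH] l0 uniw; first by rewrite big_geq.
have unw : uniq (l :: w) by case/andP: uniw.
rewrite /= IH //; case: w {IH uniw} unw => [|l' w] unw.
  by rewrite !big_geq // andbF.
rewrite [RHS]big_mkcond big_nat_recl //= -big_mkcond /=.
congr (_ + _)%N.
rewrite big_nat_cond [RHS]big_nat_cond; apply: eq_bigl => -[|i] //=.
Qed.

Section Words.
Variables (n : nat) (pi : {perm 'I_n}).

Definition word : seq nat := [seq (val (pi a)).+1 | a <- enum 'I_n].

Lemma size_word : size word = n.
Proof. by rewrite size_map size_enum_ord. Qed.

Lemma uniq_word : uniq (0%N :: word).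
Proof.
rewrite /= map_inj_uniq ?enum_uniq ?andbT; last first.
  by move=> a b [] /val_inj/perm_inj.
by apply/mapP=> -[].
Qed.

Lemma left_peaksE : left_peaks pi = peaks 0 word.
Proof. by rewrite (peaksE uniq_word) size_word. Qed.

Lemma falls0_word : falls 0 word = false.
Proof. by rewrite /word; case: (enum 'I_n). Qed.

Lemma left_peaks_bound : ((left_peaks pi).*2 <= n)%N.
Proof. by have := peaks_bound 0 word; rewrite left_peaksE falls0_word addn0 size_word. Qed.

End Words.

Section Labelings.
Variables (n M : nat).
Implicit Types (g : {ffun 'I_n -> 'I_M.+1}) (pi : {perm 'I_n}).

Definition label_key g (i : 'I_n) : nat * nat := ((val i).+1, val (g i)).

Definition label_lt g : rel 'I_n := relpre (label_key g) enriched_lt.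

Definition sorting g pi : bool := sorted (label_lt g) [seq pi a | a <- enum 'I_n].

Lemma label_lt_trans g : transitive (label_lt g).
Proof. by move=> j i k; apply: enriched_lt_trans. Qed.

Lemma label_lt_total g (i j : 'I_n) : i != j -> label_lt g i j || label_lt g j i.
Proof. by move=> neij; apply: enriched_lt_total; rewrite /= eqSS. Qed.

Lemma sortingP g pi :
  reflect (forall a b, label_lt g (pi a) (pi b) = (a < b)%N) (sorting g pi).
Proof.
have ordlt (a b : 'I_n) (r : rel 'I_n) : pairwise r (enum 'I_n) -> (a < b)%N -> r a b.
  move/(pairwiseP a) => pw ltab.
  by have := pw a b; rewrite !inE size_enum_ord !nth_ord_enum; apply.
rewrite /sorting sorted_map sorted_pairwise; last first.
  by move=> j i k; apply: enriched_lt_trans.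
apply: (iffP idP) => [srt a b|srt].
  case: (ltngtP a b) => [ltab|ltba|/val_inj->].
  - exact: ordlt srt ltab.
  - apply/negP=> /enriched_lt_trans/(_ (ordlt _ _ _ srt ltba)).
    by rewrite enriched_lt_irr.
  - exact: enriched_lt_irr.
apply: (sub_pairwise (r := relpre val ltn)) => [a b ltab|]; first by rewrite /= srt.
rewrite -pairwise_map val_enum_ord -sorted_pairwise ?iota_ltn_sorted //.
exact: ltn_trans.
Qed.

Lemma sorting_unique g pi pi' : sorting g pi -> sorting g pi' -> pi = pi'.
Proof.
move=> srt srt'; apply/permP => a.
have eqs : [seq pi a | a <- enum 'I_n] = [seq pi' a | a <- enum 'I_n].
  apply: (irr_sorted_eq (@label_lt_trans g)) => // [i|i].
    exact: enriched_lt_irr.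
  rewrite -[i in LHS](permKV pi) -[i in RHS](permKV pi').
  by rewrite !(mem_map perm_inj) !mem_enum.
by have/eq_in_map := eqs; apply; rewrite mem_enum.
Qed.

Lemma sorting_exists g : exists pi, sorting g pi.
Proof.
(* Sorting uses a total, hence reflexive, relation; the strict order is recovered because the list
   has no repetition. *)
pose r : rel 'I_n := [rel i j | (i == j) || label_lt g i j].
have r_total : total r.
  by move=> i j; rewrite /r /=; case: eqVneq => //= /(label_lt_total g).
have : perm_eq (sort r (enum 'I_n)) (ord_tuple n) by rewrite perm_sort val_ord_tuple.
case/tuple_permP=> pi eqs; exists pi.
have {}eqs : sort r (enum 'I_n) = [seq pi a | a <- enum 'I_n].
  by rewrite eqs /=; under eq_map => a do rewrite tnth_ord_tuple.
rewrite /sorting -eqs; have := sort_sorted r_total (enum 'I_n).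
have r_trans : transitive r.
  move=> j i k /predU1P[->//|ltij] /predU1P[<-|ltjk]; apply/predU1P; right => //.
  exact: label_lt_trans ltij ltjk.
rewrite !sorted_pairwise //; last exact: label_lt_trans.
have : uniq (sort r (enum 'I_n)) by rewrite sort_uniq enum_uniq.
rewrite uniq_pairwise => uns srt.
have : pairwise [rel i j | (i != j) && r i j] (sort r (enum 'I_n)).
  by rewrite pairwise_relI uns.
by apply: sub_pairwise => i j /andP[neij] /predU1P[/eqP|//]; rewrite (negPf neij).
Qed.

(** Reading the values of [g] along [pi] turns the sorted labelings into the tuples counted by
    [chain_countE]. *)
Lemma card_sorting pi : ~~ odd M ->
  #|[set g | sorting g pi]| = chain_count 0 (word pi) M.
Proof.
move=> evM; rewrite -[M in RHS]subn0 -(chain_countE _ evM (size_word pi) (leq0n M)).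
rewrite -sum1dep_card big_mkcond /=.
pose phi (t : n.-tuple 'I_M.+1) : {ffun 'I_n -> 'I_M.+1} := [ffun i => tnth t (pi^-1 i)%g].
rewrite (reindex phi) /=; last first.
  exists (fun g => [tuple g (pi a) | a < n]) => [t _|g _].
    by apply: eq_from_tnth => a; rewrite tnth_mktuple ffunE permK.
  by apply/ffunP => i; rewrite ffunE tnth_mktuple permKV.
apply: eq_bigr => t _.
have -> : zip (word pi) (map val t) = [seq label_key (phi t) (pi a) | a <- enum 'I_n].
  rewrite /word -[X in map val X](map_tnth_enum t) -(map_comp val) zip_map.

  by apply: eq_map => a; rewrite /label_key /= ffunE permK.
rewrite /sorting /label_lt -sorted_map -map_comp.
case: (enum 'I_n) => //= a s.
(* The starting pair (0, 0) precedes every pair with a positive letter, as ties at the even value 0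
   go by increasing letters. *)
rewrite [X in _ = nat_of_bool (X && _)](_ : _ = true) /=; first by case: path.
by rewrite /enriched_lt /= andbT orbC -leq_eqVlt.
Qed.

End Labelings.

(** Left enriched P-partitions: absolute values weakly increase along P, and a tie of absolute
    values forces the value at the larger element to be nonnegative. *)
Definition enriched_partition (n M : nat) (lt : rel 'I_n) (g : {ffun 'I_n -> 'I_M.+1}) :=
  [forall i, forall j, lt i j ==> (g i < g j)%N || (g i == g j) && ~~ odd (g i)].

(** As i <_P j implies i < j, the tie rule of [label_lt] on such a pair is the enriched condition.
    Both sides then say that the order of the keys extends P. *)
Lemma enriched_partition_linear (n M : nat) (lt : rel 'I_n)
    (g : {ffun 'I_n -> 'I_M.+1}) (pi : {perm 'I_n}) :
  naturally_labeled lt -> sorting g pi ->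
  enriched_partition lt g = linear_extension lt pi.
Proof.
move=> lt_nat /sortingP srt.
have key i j : lt i j ->
  label_lt g i j = (g i < g j)%N || (g i == g j) && ~~ odd (g i).
  move=> /lt_nat ltij; rewrite /label_lt /enriched_lt /= !ltnS ltij.
  by rewrite (ltnNge j) (ltnW ltij); case: ifP.
apply/forallP/forallP => h.
  move=> a; apply/forallP => b; apply/implyP => ltab; rewrite -srt key //.
  by have /forallP/(_ (pi b))/implyP/(_ ltab) := h (pi a).
move=> i; apply/forallP => j; apply/implyP => ltij; rewrite -key //.
have /forallP/(_ (pi^-1 j)%g)/implyP := h (pi^-1 i)%g.
by rewrite -srt !permKV; apply.
Qed.

Lemma card_enriched_partition (n M : nat) (lt : rel 'I_n) :
  naturally_labeled lt -> ~~ odd M ->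
  #|[set g : {ffun 'I_n -> 'I_M.+1} | enriched_partition lt g]| =
  (\sum_(pi : {perm 'I_n} | linear_extension lt pi) chain_count 0 (word pi) M)%N.
Proof.
move=> lt_nat evM; rewrite -sum1dep_card.
under [RHS]eq_bigr => pi _ do rewrite -(card_sorting pi evM) -sum1dep_card.
rewrite (exchange_big_dep (enriched_partition lt)) /=; last first.
  by move=> pi g linpi srt; rewrite (enriched_partition_linear lt_nat srt).
apply: eq_bigr => g entg; have [pi srt] := sorting_exists g.
rewrite (big_pred1 pi) // => pi' /=; apply/andP/eqP => [[_ srt']|->].
  exact: sorting_unique srt' srt.
by rewrite -(enriched_partition_linear lt_nat srt).
Qed.

(** * Lattice points of the enriched chain polytope *)

Section LatticePoints.
Variables (R : realType) (n : nat) (lt : rel 'I_n).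
Hypotheses (lt_trans : transitive lt) (lt_nat : naturally_labeled lt).

Lemma label_ind (P : 'I_n -> Prop) :
  (forall i, (forall j, lt j i -> P j) -> P i) -> forall i, P i.
Proof.
move=> IH i; have [k] := ubnP (val i); elim: k i => // k IHk i ltik.
by apply: IH => j /lt_nat ltji; apply: IHk; apply: leq_trans ltji _.
Qed.

Lemma antichain_lt (A : {set 'I_n}) (i j : 'I_n) :
  antichain lt A -> i \in A -> j \in A -> lt i j = false.
Proof.
move=> antiA Ai Aj; have [eqij|neij] := eqVneq i j.
  by apply/negP=> /lt_nat; rewrite eqij ltnn.
by have [/negbTE] := antiA i j Ai Aj neij.
Qed.

Lemma bigmax_predecessor (f : 'I_n -> nat) (i : 'I_n) :
  (exists2 j, lt j i & \max_(k | lt k i) f k = f j) \/ \max_(k | lt k i) f k = 0%N.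
Proof.
have [none|some] := posnP #|[pred j | lt j i]|; [right|left].
  by rewrite big_pred0 //; apply: card0_eq.
by have [j ltji eqf] := eq_bigmax_cond f some; exists j.
Qed.

Section Encoding.
Variable M : nat.
Implicit Types g : {ffun 'I_n -> 'I_M.+1}.

(** The absolute value: the codes 2k - 1 and 2k both give k. *)
Definition level g (i : 'I_n) : nat := uphalf (g i).

Definition below g (i : 'I_n) : nat := \max_(j | lt j i) level g j.

(* The value 2 k encodes the enriched value k and 2 k - 1 encodes - k; the
   coordinates are the increments of the absolute values along P, with sign. *)
Definition lattice_point g : 'rV[R]_n :=
  \row_i ((-1) ^+ odd (g i) * (level g i - below g i)%N%:R).

Lemma below_le g i : enriched_partition lt g -> (below g i <= level g i)%N.
Proof.
move=> /forallP entg; apply/bigmax_leqP => j ltji.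
have /forallP/(_ i)/implyP/(_ ltji) := entg j.
rewrite /level; case/orP=> [/ltnW|/andP[/eqP-> _]] //.
exact: uphalf_leq.
Qed.

(** A zero coordinate records no sign, so the sign has to be forced: a value - k above an element of
    absolute value k would break the enriched condition. *)
Lemma level_eq_below g i : enriched_partition lt g ->
  level g i = below g i -> g i = (level g i).*2 :> nat.
Proof.
move=> /forallP entg eqlb; have evg : ~~ odd (g i); last first.
  by rewrite /level uphalf_half (negbTE evg) add0n even_halfK.
apply/negP=> oddg; have lev_gt0 : (0 < level g i)%N.
  by rewrite /level; case: (nat_of_ord (g i)) oddg.
have [[j ltji]|] := bigmax_predecessor (level g) i; last first.
  by rewrite -/(below g i) -eqlb => lev0; rewrite lev0 in lev_gt0.
rewrite -/(below g i) => eqbj.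
have /forallP/(_ i)/implyP/(_ ltji) := entg j; move: oddg eqlb; rewrite eqbj /level.
by rewrite -val_eqE /=; lia.
Qed.

Lemma lattice_point_inj (g g' : {ffun 'I_n -> 'I_M.+1}) :
  enriched_partition lt g -> enriched_partition lt g' ->
  lattice_point g = lattice_point g' -> g = g'.
Proof.
move=> entg entg' eqx; apply/ffunP; apply: label_ind => i IH.
have eqb : below g i = below g' i.
  by apply: eq_bigr => j ltji; rewrite /level IH.
have /rowP/(_ i) := eqx; rewrite !mxE => eqxi.
have := congr1 Num.norm eqxi; rewrite !normrMsign !normr_nat => /eqP.
rewrite eqr_nat => /eqP eqd.
have leb := below_le i entg; have leb' := below_le i entg'.
have eql : level g i = level g' i by lia.
have [eqlb|nelb] := eqVneq (level g i) (below g i).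
  apply: val_inj; rewrite /= (level_eq_below entg eqlb) eql.
  by rewrite -level_eq_below // -eql eqlb eqb.
have d_neq0 : (level g' i - below g' i)%N%:R != 0 :> R.
  by rewrite pnatr_eq0 -eqd; lia.
have eqo : odd (g i) = odd (g' i).
  by apply: (@signr_inj R); apply: (mulIf d_neq0); rewrite -{1}eqd.
move: eql eqo; rewrite /level => eql eqo; apply: val_inj => /=.
rewrite -[LHS]odd_double_half -[RHS]odd_double_half.
by move: eql eqo; rewrite !uphalf_half; lia.
Qed.

End Encoding.

Lemma lattice_point_int (M : nat) (g : {ffun 'I_n -> 'I_M.+1}) :
  integer_points (lattice_point g).
Proof.
by move=> i; rewrite mxE rpredM ?natr_int // rpredX // rpredN rpred1.
Qed.

Lemma lattice_point_polytope (m : nat) (g : {ffun 'I_n -> 'I_m.*2.+1}) :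
  (0 < m)%N -> enriched_partition lt g ->
  exists2 y, enriched_chain_polytope R lt y & m%:R *: y = lattice_point g.
Proof.
move=> m_gt0 entg.
have m_neq0 : m%:R != 0 :> R by rewrite pnatr_eq0 -lt0n.
(* Slices the point into m layers. If i <_P j, then [level g i] is at most [below g j], so no layer
   contains both and each layer is an antichain. *)
pose A (t : 'I_m) := [set i | (below g i <= t)%N && (t < level g i)%N].
pose v (t : 'I_m) : 'rV[R]_n := \sum_(i in A t) (-1) ^+ odd (g i) *: delta_mx 0 i.
exists (\sum_t m%:R^-1 *: v t).
  exists m, (fun=> m%:R^-1), v; split=> // [t||t].
    by rewrite invr_ge0 ler0n.
    by rewrite big_const_ord iter_addr_0 -[_ *+ _]mulr_natr mulVf.
  exists (A t), (fun i => odd (g i)); split=> //.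
  have sep i j : i \in A t -> j \in A t -> ~~ lt i j.
    rewrite !inE => /andP[_ lti] /andP[lej _]; apply/negP => ltij.
    have : (level g i <= below g j)%N by apply: (leq_bigmax_cond _ ltij).
    by lia.
  by move=> i j Ai Aj _; rewrite !sep.
rewrite scaler_sumr; apply/rowP => i; rewrite summxE mxE.
under eq_bigr => t _.
  rewrite scalerA mulfV // scale1r /v summxE.
  under eq_bigr => j _ do rewrite !mxE eqxx /=.
  rewrite big_mkcond (bigD1 i) //= big1 ?addr0 => [|j neji]; last first.
    by rewrite eq_sym (negbTE neji) mulr0 if_same.
  rewrite eqxx mulr1.
  over.
rewrite -big_mkcond /= sumr_const -[LHS]mulr_natr; congr (_ * _%:R).
have lem : (level g i <= m)%N.
  by have := ltn_ord (g i); rewrite /level; lia.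
have leb := below_le i entg.
have -> : (level g i - below g i = \sum_(below g i <= t < level g i) 1)%N.
  by rewrite sum_nat_const_nat muln1.
rewrite (big_nat_widenl _ 0) // (big_nat_widen _ _ m) // big_mkord sum1_card.
by apply: eq_card => t; apply: esym; rewrite [LHS]inE unfold_in /= -[RHS]/(i \in A t) inE.
Qed.

Lemma level_recursion (a : 'I_n -> nat) :
  exists f : 'I_n -> nat, forall i, f i = (a i + \max_(j | lt j i) f j)%N.
Proof.
pose F k := iter k (fun (f : 'I_n -> nat) i => (a i + \max_(j | lt j i) f j)%N) (fun=> 0%N).
(* Predecessors have smaller labels, so the iterate at i is final after i + 1 rounds. *)
have stable k (i : 'I_n) : (i < k)%N -> F k.+1 i = F k i.
  elim: k i => // k IH i ltik; rewrite /F iterS [in RHS]iterS -/(F k) -/(F k.+1).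
  congr addn; apply: eq_bigr => j /lt_nat ltji; apply: IH.
  by apply: leq_trans ltji _.
by exists (F n) => i; rewrite -[in LHS]stable.
Qed.

Lemma polytope_lattice_point (m : nat) (y : 'rV[R]_n) :
  enriched_chain_polytope R lt y -> integer_points (m%:R *: y) ->
  exists2 g : {ffun 'I_n -> 'I_m.*2.+1},
    enriched_partition lt g & lattice_point g = m%:R *: y.
Proof.
move=> [k [w [v [w_ge0 w_sum vP def_y]]]] int_x.
have /fin_all_exists[AS AS_P] : forall l, exists As : {set 'I_n} * ('I_n -> bool),
    antichain lt As.1 /\ v l = \sum_(i in As.1) (-1) ^+ As.2 i *: delta_mx 0 i.
  by move=> l; have [A [s [antiA def_v]]] := vP l; exists (A, s).
pose A l := (AS l).1.
have antiA l : antichain lt (A l) by case: (AS_P l).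
have norm_v l i : `|v l 0 i| = (i \in A l)%:R.
  have [_ ->] := AS_P l; rewrite summxE.
  under eq_bigr => j _ do rewrite !mxE eqxx /=.
  rewrite big_mkcond (bigD1 i) //= big1 ?addr0 => [|j neji]; last first.
    by rewrite eq_sym (negbTE neji) mulr0 if_same.
  rewrite eqxx mulr1 /A; case: ifP => _; last by rewrite normr0.
  by rewrite normr_sign.
pose x := m%:R *: y.
have /fin_all_exists[a aP] : forall i, exists a : nat, `|x 0 i| = a%:R.
  move=> i; have /intrP[z ->] := int_x i; exists `|z|%N.
  by rewrite -intr_norm -abszE -pmulrn.
have a_le i : (a i)%:R <= m%:R * \sum_l w l * (i \in A l)%:R :> R.
  rewrite -aP /x mxE normrM normr_nat ler_wpM2l ?ler0n // def_y summxE.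
  apply: le_trans (ler_norm_sum _ _ _) _; apply: ler_sum => l _.
  by rewrite mxE normrM norm_v ger0_norm.
(* The largest sum of the a over a chain ending at i is f i; it will be the level of i. *)
have [f fP] := level_recursion a.
pose down i := [set j | (j == i) || lt j i].
(* An antichain containing i misses everything strictly below i, so the weights used at i and at its
   predecessors never overlap. The total weight being 1, this bounds f i by m. *)
have f_le i : (f i)%:R <= m%:R * \sum_l w l * (~~ [disjoint down i & A l])%:R :> R.
  elim/label_ind: i => i IH; rewrite fP natrD.
  have [[j ltji ->]| ->] := bigmax_predecessor f i; last first.
    rewrite addr0.
    apply: le_trans (a_le i) _; rewrite ler_wpM2l ?ler0n //.
    apply: ler_sum => l _; rewrite ler_wpM2l // ler_nat.
    case: (boolP (i \in A l)) => // Ai; rewrite lt0b; apply/pred0Pn.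
    by exists i; rewrite /= Ai inE eqxx.
  apply: le_trans (lerD (a_le i) (IH j ltji)) _; rewrite -mulrDr.
  rewrite ler_wpM2l ?ler0n // -big_split /=; apply: ler_sum => l _.
  rewrite -mulrDr ler_wpM2l // -natrD ler_nat.
  have [dis|/pred0Pn[j' /andP[]]] := boolP [disjoint down j & A l].
    rewrite addn0; case: (boolP (i \in A l)) => // Ai; rewrite lt0b; apply/pred0Pn.
    by exists i; rewrite /= Ai inE eqxx.
  move=> dj' Aj'; rewrite !inE in dj'.
  have ltj'i : lt j' i by case/orP: dj' => [/eqP-> //|ltj'j]; apply: lt_trans ltj'j ltji.
  have -> : (i \in A l) = false.
    by apply/negP => Ai; have := antichain_lt (antiA l) Aj' Ai; rewrite ltj'i.
  rewrite add0n lt0b; apply/pred0Pn; exists j'.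
  by apply/andP; split; rewrite /= ?inE ?ltj'i ?orbT.
have f_bound i : (f i <= m)%N.
  rewrite -(ler_nat R); apply: le_trans (f_le i) _.
  rewrite -[leRHS]mulr1 ler_wpM2l ?ler0n // -[leRHS]w_sum; apply: ler_sum => l _.
  by rewrite -[leRHS]mulr1 ler_wpM2l // lern1; case: (~~ _).
pose s i := x 0 i < 0.
have xE i : x 0 i = (-1) ^+ s i * (a i)%:R.
  by rewrite -aP /s -numEsign.
have a_gt0 i : s i -> (0 < a i)%N.
  by rewrite /s lt0n -(pnatr_eq0 R) -aP normr_eq0 lt_def eq_sym => /andP[].
have a_lef i : (a i <= f i)%N by rewrite fP leq_addr.
pose g : {ffun 'I_n -> 'I_m.*2.+1} := [ffun i => inord ((f i).*2 - s i)].
have gE i : g i = ((f i).*2 - s i)%N :> nat.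
  by rewrite ffunE inordK // ltnS; have := f_bound i; lia.
have lev i : level g i = f i.
  by rewrite /level gE; have := a_gt0 i; have := a_lef i; case: (s i); lia.
have odd_g i : odd (g i) = s i.
  by rewrite gE; have := a_gt0 i; have := a_lef i; case: (s i) => /=; lia.
exists g.
  apply/forallP => i; apply/forallP => j; apply/implyP => ltij.
  rewrite -val_eqE /= odd_g !gE; have := a_gt0 j; have := a_gt0 i.
  (* In a tie of absolute values this forces a j = 0, so the value at j is not negative. *)
  have : (f i + a j <= f j)%N.
    by rewrite [f j]fP addnC leq_add2l; apply: (leq_bigmax_cond _ ltij).
  have := a_lef i; case: (s i); case: (s j) => /=; lia.
apply/rowP => i; rewrite [LHS]mxE odd_g lev -/x xE; congr (_ * _%:R).
have -> : below g i = \max_(j | lt j i) f j by apply: eq_bigr => j _; exact: lev.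
by rewrite fP addnK.
Qed.

Lemma lattice_countE (m : nat) : (0 < m)%N ->
  lattice_count (enriched_chain_polytope R lt) m =
  #|[set g : {ffun 'I_n -> 'I_m.*2.+1} | enriched_partition lt g]|.
Proof.
move=> m_gt0; rewrite /lattice_count.
set G := [set g : {ffun 'I_n -> 'I_m.*2.+1} | enriched_partition lt g].
have -> : ([set m%:R *: x | x in enriched_chain_polytope R lt] `&` @integer_points R n =
    [set` [fset lattice_point g | g in G]%fset])%classic.
  apply/seteqP; split=> [_ [[y Ey <-] int_y]|x] /=.
    have [g entg <-] := polytope_lattice_point Ey int_y.
    by apply/imfsetP; exists g; rewrite //= inE.
  case/imfsetP=> g /=; rewrite inE => entg ->.
  split; last exact: lattice_point_int.
  by have [y Ey <-] := lattice_point_polytope m_gt0 entg; exists y.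
rewrite set_fsetK card_in_imfset /=; last first.
  move=> g g'; rewrite !inE => entg entg'; exact: lattice_point_inj.
by rewrite -cardE.
Qed.

End LatticePoints.

(** * The h*-polynomial *)

(** Each summand of [hstar_poly] is palindromic for the degree a + 2 k, which is n for every linear
    extension. *)
Lemma palindromic_term (F : fieldType) (x c : F) (a k : nat) : x != 0 ->
  (1 + x) ^+ a * (c * x) ^+ k =
  x ^+ a * (x ^+ k * x ^+ k) * ((1 + 'X) ^+ a * (c%:P * 'X) ^+ k).[x^-1].
Proof.
move=> x_neq0; rewrite -polyC1 hornerM !horner_exp hornerD hornerM !hornerC hornerX.
have -> : 1 + x = x * (1 + x^-1) by rewrite mulrDr mulfV // mulr1 addrC.
have -> : c * x = x * x * (c * x^-1) by field.
by rewrite !exprMn; ring.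
Qed.

Section HstarPolynomial.
Variables (R : realType) (n : nat) (lt : rel 'I_n).

(** This is (1 + x)^n W_P(4 x / (1 + x)^2) with denominators cleared term by term, by
    [left_peaks_bound]. *)
Definition hstar_poly : {poly R} :=
  \sum_(pi : {perm 'I_n} | linear_extension lt pi)
    (1 + 'X) ^+ (n - (left_peaks pi).*2) * (4%:R *: 'X) ^+ left_peaks pi.

Lemma hstar_poly_is_hstar : transitive lt -> naturally_labeled lt ->
  is_hstar (enriched_chain_polytope R lt) hstar_poly.
Proof.
move=> lt_trans lt_nat k.
have ehr j : (ehrhart_series_coef (enriched_chain_polytope R lt) j)%:R =
    \sum_(pi | linear_extension lt pi) even_count R 0 (word pi) j.
  rewrite -natr_sum -card_enriched_partition ?odd_double //; congr _%:R.
  (* For j = 0 the conventional coefficient 1 counts the zero labeling, the only one with values in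
     {0}. *)
  case: j => [|j]; last exact: lattice_countE.
  rewrite /= -[LHS](cards1 ([ffun=> ord0] : {ffun 'I_n -> 'I_1})); apply: eq_card => g.
  rewrite !inE; have -> : g = [ffun=> ord0] by apply/ffunP => i; rewrite !ord1.
  rewrite eqxx; apply/esym/forallP => i; apply/forallP => j.
  by apply/implyP; rewrite !ffunE.
apply/esym; apply: etrans (eq_conv ((1 - 'X) ^+ n.+1) ehr k) _.
rewrite conv_sum coef_sum.
apply: eq_bigr => pi _.
have := even_count_series R (uniq_word pi) k.
by rewrite size_word falls0_word addn0 -left_peaksE mulr1.
Qed.

Lemma is_hstar_inj (E : set 'rV[R]_n) (h h' : {poly R}) :
  is_hstar E h -> is_hstar E h' -> h = h'.
Proof. by move=> hE h'E; apply/polyP => k; rewrite hE h'E. Qed.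

(** With [left_peaks1], this supplies a term (1 + x)^n of [hstar_poly], which fixes its degree, and
    a term 1 of W_P, which makes it positive at nonnegative reals. *)
Lemma linear_extension1 : naturally_labeled lt -> linear_extension lt 1%g.
Proof.
move=> lt_nat; apply/forallP => a; apply/forallP => b; apply/implyP.
by rewrite !perm1; apply: lt_nat.
Qed.

Lemma left_peaks1 : left_peaks (1%g : {perm 'I_n}) = 0%N.
Proof.
have lettersE i : (i <= n)%N -> nth 0%N (letters (1%g : {perm 'I_n})) i = i.
  case: i => //= i lein.
  by rewrite (nth_map (Ordinal lein)) ?size_enum_ord // perm1 nth_enum_ord.
rewrite /left_peaks big_nat_cond big_pred0 // => i; apply/negP => /andP[/andP[_ ltin]].
by rewrite /is_left_peak !lettersE; lia.
Qed.

Lemma sum_left_peaks_gt0 (F : {perm 'I_n} -> R) : naturally_labeled lt ->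
  (forall pi, 0 <= F pi) -> 0 < F 1%g ->
  0 < \sum_(pi : {perm 'I_n} | linear_extension lt pi) F pi.
Proof.
move=> lt_nat F_ge0 F1_gt0; rewrite (bigD1 1%g) ?linear_extension1 //=.
by rewrite ltr_wpDr // sumr_ge0.
Qed.

Lemma coef_1addXn (m k : nat) : ((1 + 'X : {poly R}) ^+ m)`_k = 'C(m, k)%:R.
Proof.
have -> : (1 + 'X : {poly R}) ^+ m = \poly_(i < m.+1) 'C(m, i)%:R.
  rewrite addrC exprD1n poly_def; apply: eq_bigr => i _.
  by rewrite scaler_nat.
by rewrite coef_poly ltnS; case: leqP => // ltmk; rewrite bin_small.
Qed.

Lemma hstar_termE (pi : {perm 'I_n}) (k : nat) :
  ((1 + 'X : {poly R}) ^+ (n - (left_peaks pi).*2) * (4%:R *: 'X) ^+ left_peaks pi)`_k =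
  if (k < left_peaks pi)%N then 0
  else 4%:R ^+ left_peaks pi * 'C(n - (left_peaks pi).*2, k - left_peaks pi)%:R.
Proof.
rewrite exprZn -scalerAr coefZ coefMXn coef_1addXn.
by case: ifP; rewrite ?mulr0.
Qed.

Lemma size_hstar_poly : naturally_labeled lt -> size hstar_poly = n.+1.
Proof.
move=> lt_nat; apply/eqP; rewrite eqn_leq; apply/andP; split.
  apply/leq_sizeP => k ltnk; rewrite coef_sum big1 // => pi _.
  have := left_peaks_bound pi; rewrite hstar_termE => pk_le.
  by case: ifP => // _; rewrite bin_small ?mulr0 //; lia.
rewrite ltnNge; apply/negP => /leq_sizeP/(_ n (leqnn n))/eqP; apply/negP.
rewrite lt0r_neq0 // coef_sum; apply: sum_left_peaks_gt0 => // [pi|].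
  by rewrite hstar_termE; case: ifP; rewrite // mulr_ge0 ?exprn_ge0 ?ler0n.
by rewrite hstar_termE left_peaks1 /= !subn0 binn expr0 mulr1 ltr01.
Qed.

Lemma subst_fracE (f : {poly R}) (q : {fraction {poly R}}) :
  subst_frac f q = (map_poly (@tofrac {poly R} \o polyC) f).[q].
Proof. by []. Qed.

Lemma tofrac_hstar_poly :
  tofrac hstar_poly = tofrac ('X + 1) ^+ n *
    subst_frac (left_peak_poly lt R) (tofrac (4%:R *: 'X) / tofrac ('X + 1) ^+ 2).
Proof.
have X1_neq0 : tofrac ('X + 1 : {poly R}) != 0.
  by rewrite tofrac_eq0 -size_poly_gt0 -polyC1 size_XaddC.
rewrite subst_fracE /left_peak_poly /hstar_poly !rmorph_sum horner_sum mulr_sumr.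
apply: eq_bigr => pi _.
rewrite /= map_polyXn hornerXn rmorphM !rmorphXn /= expr_div_n -exprM.
rewrite mulrCA mulrC [1 + 'X]addrC; congr (_ * _).
have pk_le := left_peaks_bound pi.
rewrite -mul2n in pk_le *.
apply: (mulIf (expf_neq0 (2 * left_peaks pi) X1_neq0)).
by rewrite divfK ?expf_neq0 // -exprD subnK.
Qed.

Lemma hstar_poly_palindromic : naturally_labeled lt -> palindromic hstar_poly.
Proof.
move=> lt_nat; rewrite /palindromic /degree size_hstar_poly //=.
have X_neq0 : tofrac ('X : {poly R}) != 0 by rewrite tofrac_eq0 polyX_eq0.
rewrite subst_fracE /hstar_poly !rmorph_sum horner_sum mulr_sumr.
apply: eq_bigr => pi _; have pk_le := left_peaks_bound pi.
rewrite -mul_polyC !rmorphM !rmorphXn rmorphM rmorphD /= rmorph1.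
rewrite [map_poly _ (1 + _)]rmorphD [map_poly _ (_ * _)]rmorphM rmorph1 /= map_polyX map_polyC /=.
have -> : tofrac ('X : {poly R}) ^+ n = tofrac 'X ^+ (n - (left_peaks pi).*2) *
    (tofrac 'X ^+ left_peaks pi * tofrac 'X ^+ left_peaks pi).
  by rewrite -!exprD addnn subnK.
exact: palindromic_term.
Qed.

Lemma hstar_poly_gamma_positive : naturally_labeled lt -> gamma_positive hstar_poly.
Proof.
move=> lt_nat; split; first exact: hstar_poly_palindromic.
rewrite /degree size_hstar_poly //=.
(* The i-th gamma coefficient is 4^i times the number of linear extensions with i left peaks. *)
exists (fun i : 'I_n./2.+1 => \sum_(pi | linear_extension lt pi && (left_peaks pi == val i))
                  4%:R ^+ left_peaks pi); split=> [i|].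
  by apply: sumr_ge0 => pi _; rewrite exprn_ge0 ?ler0n.
rewrite /hstar_poly (partition_big (fun pi => inord (left_peaks pi) : 'I_n./2.+1) predT) //=.
apply: eq_bigr => i _; rewrite scaler_suml; apply: eq_big => [pi|pi /andP[_ /eqP pki]].
  have := left_peaks_bound pi; case: (linear_extension _ _) => //= pk_le.
  by rewrite -val_eqE /= inordK //; lia.
have -> : i = left_peaks pi :> nat.
  by have := left_peaks_bound pi => pk_le; rewrite -pki inordK //; lia.
by rewrite exprZn -scalerAr mulrC.
Qed.

End HstarPolynomial.

(** * Transfer of real-rootedness between h* and the left peak polynomial *)

Section RealRooted.
Variables (R : realType) (n : nat) (lt : rel 'I_n).
Hypothesis lt_nat : naturally_labeled lt.

Local Notation toC := (real_complex R).

Lemma horner_left_peak_poly (z : complex R) :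
  (map_poly toC (left_peak_poly lt R)).[z] =
  \sum_(pi : {perm 'I_n} | linear_extension lt pi) z ^+ left_peaks pi.
Proof.
rewrite /left_peak_poly rmorph_sum horner_sum; apply: eq_bigr => pi _.
by rewrite /= map_polyXn hornerXn.
Qed.

Lemma horner_hstar_poly (z : complex R) : 1 + z != 0 ->
  (map_poly toC (hstar_poly R lt)).[z] =
  (1 + z) ^+ n * (map_poly toC (left_peak_poly lt R)).[4%:R * z / (1 + z) ^+ 2].
Proof.
move=> z1_neq0; rewrite horner_left_peak_poly /hstar_poly rmorph_sum horner_sum mulr_sumr.
apply: eq_bigr => pi _; have pk_le := left_peaks_bound pi.
have -> : (1 + z) ^+ n = (1 + z) ^+ (n - (left_peaks pi).*2) * (1 + z) ^+ 2 ^+ left_peaks pi.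
  by rewrite -exprM mul2n -exprD subnK.
rewrite -mulrA -exprMn [_ ^+ 2 * _]mulrC divfK ?expf_neq0 //.
rewrite rmorphM !rmorphXn /= [map_poly _ (1 + _)]rmorphD rmorph1 /= map_polyX.
by rewrite map_polyZ /= map_polyX !hornerE rmorph_nat mulrC.
Qed.

Lemma left_peak_poly_gt0 (r : R) : 0 <= r -> 0 < (left_peak_poly lt R).[r].
Proof.
move=> r_ge0; rewrite /left_peak_poly horner_sum.
under eq_bigr => pi _ do rewrite hornerXn.
apply: sum_left_peaks_gt0 => // [pi|]; first exact: exprn_ge0.
by rewrite left_peaks1 expr0 ltr01.
Qed.

Lemma left_peak_poly_real_root (r : R) :
  root (map_poly toC (left_peak_poly lt R)) (toC r) -> r < 0.
Proof.
rewrite fmorph_root => /rootP rt; rewrite ltNge; apply/negP => /left_peak_poly_gt0.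
by rewrite rt ltxx.
Qed.

(* For r < 0, the discriminant 16 (1 - r) of r (1 + z)^2 - 4 z is positive. *)
Lemma peak_substitution_real (r : R) (z : complex R) :
  r < 0 -> 4%:R * z = toC r * (1 + z) ^+ 2 -> complex.Im z = 0.
Proof.
case: z => a b r_lt0 eqz /=; have [->//|b_neq0] := eqVneq b 0.
have eqRe : 4%:R * a = r * ((1 + a) ^+ 2 - b ^+ 2).
  have := congr1 (@complex.Re R) eqz.
  by rewrite mulr_natl expr2 raddfMn /= -[LHS]mulr_natl => ->; ring.
have eqIm : b * (r * (1 + a)) = b * 2%:R.
  have := congr1 (@complex.Im R) eqz.
  rewrite mulr_natl expr2 raddfMn /= -[LHS]mulr_natl => eqb; lra.
have {}eqIm := mulfI b_neq0 eqIm.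
(* Multiply [eqRe] by r and replace r (1 + a) by 2; the resulting square is negative for r < 0. *)
have : (r * b) ^+ 2 = 4%:R * r - 4%:R by nra.
by have := sqr_ge0 (r * b); lra.
Qed.

Lemma real_rooted_hstar_poly :
  real_rooted (hstar_poly R lt) <-> real_rooted (left_peak_poly lt R).
Proof.
split=> [hR u ru|WR z rz].
  have u_neq0 : u != 0.
    apply/eqP => u0; move: ru; rewrite u0 -(rmorph0 toC).
    by move/left_peak_poly_real_root; rewrite ltxx.
  (* The quadratic formula for u z^2 + (2 u - 4) z + u = 0, that is, for 4 z = u (1 + z)^2. *)
  pose s := sqrtC (1 - u); pose z := (2%:R - u + 2%:R * s) / u.
  have sE : u = 1 - s ^+ 2 by rewrite sqrtCK; ring.
  have zE : 4%:R * z = u * (1 + z) ^+ 2.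
    by rewrite /z; move: u_neq0; rewrite sE => ?; field.
  have z1_neq0 : 1 + z != 0.
    apply/eqP => z1; move: zE; rewrite z1 expr0n mulr0 => /eqP.
    rewrite mulf_eq0 pnatr_eq0 /= => /eqP z0.
    by move/eqP: z1; rewrite z0 addr0 oner_eq0.
  have uE : u = 4%:R * z / (1 + z) ^+ 2 by rewrite zE mulfK // expf_neq0.
  have rz : root (map_poly toC (hstar_poly R lt)) z.
    by apply/rootP; rewrite horner_hstar_poly // -uE (rootP ru) mulr0.
  have zR : z = toC (complex.Re z) by have := hR z rz; case: (z) => a b /= ->.
  have -> : u = toC (4%:R * complex.Re z / (1 + complex.Re z) ^+ 2).
    by rewrite rmorphM fmorphV rmorphXn rmorphD rmorph1 rmorphM rmorph_nat /= -zR -uE.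
  by [].
(* The substitution is undefined at z = -1, but this root is real. *)
have [z1|z1_neq0] := eqVneq (1 + z) 0.
  by have -> : z = toC (-1); [rewrite rmorphN1; apply/eqP; rewrite -addr_eq0 addrC z1|].
have rW : root (map_poly toC (left_peak_poly lt R)) (4%:R * z / (1 + z) ^+ 2).
  move/rootP: rz; rewrite horner_hstar_poly // => /eqP.
  by rewrite mulf_eq0 expf_eq0 (negPf z1_neq0) andbF.
have := rW; have := WR _ rW; set u := 4%:R * z / _ => Imu.
have -> : u = toC (complex.Re u) by move: Imu; case: (u) => a b /= ->.
move/left_peak_poly_real_root => r_lt0; apply: (peak_substitution_real r_lt0).
have -> : toC (complex.Re u) = u by move: Imu; case: (u) => a b /= ->.
by rewrite /u divfK // expf_neq0.
Qed.

End RealRooted.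

Theorem theorem0p3 (R : realType) (n : nat) (lt : rel 'I_n)
    (lt_irr : irreflexive lt) (lt_trans : transitive lt)
    (lt_nat : naturally_labeled lt) :
  exists h : {poly R},
    [/\ unique (is_hstar (enriched_chain_polytope R lt)) h,
        tofrac h = tofrac ('X + 1) ^+ n *
          subst_frac (left_peak_poly lt R) (tofrac (4%:R *: 'X) / tofrac ('X + 1) ^+ 2),
        gamma_positive h
      & real_rooted h <-> real_rooted (left_peak_poly lt R)].
Proof.
have hP := hstar_poly_is_hstar R lt_trans lt_nat.
exists (hstar_poly R lt); split.
- by split=> // h' /(is_hstar_inj hP).
- exact: tofrac_hstar_poly.
- exact: hstar_poly_gamma_positive.
- exact: real_rooted_hstar_poly.
Qed.
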